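(* Let $K\ge 2$ be an integer and let $0\le p\le q\le 1$. Then $$\dim_H E_{\sigma_K}([p,q])=\dim_H D_{\sigma_K}([p,q])=2-q.$$
   Context: $\Sigma_K=\{0,\dots,K-1\}^{\mathbb{N}}$ with $\mathbb{N}=\{0,1,2,\dots\}$, endowed with the metric $\rho(x,y)=K^{-\delta(x,y)}$, where $\delta(x,y)=\inf\{i\ge 0:x_i\ne y_i\}$ ($\rho(x,x)=0$). The shift map $\sigma_K:\Sigma_K\to\Sigma_K$ is $(\sigma_K(x))_i=x_{i+1}$. The product $\Sigma_K\times\Sigma_K$ carries the sup metric. For a continuous surjective self-map $f$ of a compact metric space $(X,\rho)$, for $x,y\in X$ and $\epsilon>0$, put $$F_{x,y}(\epsilon)=\liminf_{n\to\infty}\tfrac1n\#\{0\le i<n:\rho(f^i(x),f^i(y))<\epsilon\},\quad F^*_{x,y}(\epsilon)=\limsup_{n\to\infty}\tfrac1n\#\{0\le i<n:\rho(f^i(x),f^i(y))<\epsilon\}.$$ For $0\le p\le q\le1$, $$E_f([p,q])=\{(x,y)\in X\times X:\lim_{\epsilon\to0^+}F^*_{x,y}(\epsilon)=q,\ \lim_{\epsilon\to0^+}F_{x,y}(\epsilon)=p\},$$ $$D_f([p,q])=\{(x,y)\in X\times X:\text{there is }\epsilon_0>0\text{ with }F^*_{x,y}(\epsilon)=q\text{ and }F_{x,y}(\epsilon)=p\text{ for all }\epsilon\in(0,\epsilon_0]\}.$$ $\dim_H$ is Hausdorff dimension. *)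

(* Defs.v *)
From HB Require Import structures.
From mathcomp Require Import all_boot all_order all_algebra.
From mathcomp Require Import all_classical all_reals all_analysis.

Set Implicit Arguments.
Unset Strict Implicit.
Unset Printing Implicit Defensive.

Import Order.TTheory GRing.Theory Num.Theory.
Import numFieldNormedType.Exports.

Local Open Scope classical_set_scope.
Local Open Scope ring_scope.

(* [R] is a phantom parameter: without it, the instances below, whose distance
   is [R]-valued, could not be inferred from the carrier alone. *)
Definition fullshift (R : realType) (K : nat) : Type := nat -> 'I_K.

HB.instance Definition _ (R : realType) (K : nat) :=
  Choice.copy (fullshift R K) (nat -> 'I_K).

Section fullshift_metric.
Context (R : realType) (K : nat).
Implicit Types x y z : fullshift R K.

Definition fs_dist x y : R :=
  match pselect (exists i, x i != y i) with
  | left neq_xy => (K%:R : R) ^- ex_minn neq_xy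
  | right _ => 0
  end.

Let fs_dist_ge x y i : x i != y i -> (K%:R : R) ^- i <= fs_dist x y.
Proof.
move=> xyi; rewrite /fs_dist; case: pselect => [h|]; last by case; exists i.
have K0 : (0 < K)%N by case: (x i) => j; exact: leq_ltn_trans.
case: ex_minnP => m _ /(_ _ xyi) mi.
by rewrite lef_pV2 ?posrE ?exprn_gt0 ?ltr0n// ler_weXn2l// ler1n.
Qed.

Let fs_dist_ge0 x y : 0 <= fs_dist x y.
Proof.
by rewrite /fs_dist; case: pselect => // h; rewrite invr_ge0 exprn_ge0.
Qed.

Let fs_distxx x : fs_dist x x = 0.
Proof.
rewrite /fs_dist; case: pselect => // h; have [i] := h.
by rewrite eqxx.
Qed.

Let fs_dist_eq0 x y : fs_dist x y = 0 -> x = y.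
Proof.
move=> d0; apply/funext => i; apply/eqP/negPn/negP => xyi.
have := fs_dist_ge xyi; rewrite d0 leNgt invr_gt0 exprn_gt0//.
by rewrite ltr0n; case: (x i) => j; exact: leq_ltn_trans.
Qed.

Let fs_distC x y : fs_dist x y = fs_dist y x.
Proof.
rewrite /fs_dist; case: pselect => h1; case: pselect => h2 //.
- by congr (_ ^- _); apply: eq_ex_minn => j; rewrite eq_sym.
- by have [j xyj] := h1; case: h2; exists j; rewrite eq_sym.
- by have [j xyj] := h2; case: h1; exists j; rewrite eq_sym.
Qed.

Let fs_dist_triangle y x z : fs_dist x z <= fs_dist x y + fs_dist y z.
Proof.
rewrite {1}/fs_dist; case: pselect => [h|_]; last by rewrite addr_ge0.
case: ex_minnP => m xzm _; have [xym|/fs_dist_ge xym] := eqVneq (x m) (y m).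
- by rewrite xym in xzm; rewrite (le_trans (fs_dist_ge xzm))// lerDr.
- by rewrite (le_trans xym)// lerDl.
Qed.

HB.instance Definition _ := @isMetric.Build R (fullshift R K)
  fs_dist fs_distxx fs_dist_eq0 fs_distC fs_dist_triangle.

End fullshift_metric.

Definition fs_shift (R : realType) (K : nat) (x : fullshift R K) :
  fullshift R K := fun i => x i.+1.

(* The library's product is only a pseudometric space (with the sup
   pseudometric); this supplies the distance inducing its balls. *)
Section prod_metric.
Context (R : realType) (T U : metricType R).
Implicit Types x y : T * U.

Definition prod_dist x y : R :=
  Num.max (mdist x.1 y.1) (mdist x.2 y.2).

Let prod_dist_ge0 x y : 0 <= prod_dist x y.
Proof. by rewrite le_max mdist_ge0. Qed.

Let prod_dist_eq0 x y : prod_dist x y = 0 -> x = y.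
Proof.
move=> d0; have /andP[d1 d2] : (mdist x.1 y.1 <= 0) && (mdist x.2 y.2 <= 0).
  by rewrite -ge_max -/(prod_dist x y) d0.
case: x y d1 d2 {d0} => x1 x2 [y1 y2] /= d1 d2.
by congr pair; apply: mdist_positivity; apply/eqP; rewrite eq_le mdist_ge0 andbT.
Qed.

Let prod_ballE x e : ball x e = [set y | prod_dist x y < e].
Proof.
apply/seteqP; split => y; rewrite /prod_dist /= gt_max.
- by move=> [] /=; rewrite !ballEmdist /= => -> ->.
- by move=> /andP[]; split => /=; rewrite ballEmdist.
Qed.

HB.instance Definition _ := @PseudoMetric_isMetric.Build R (T * U)%type
  prod_dist prod_dist_ge0 prod_dist_eq0 prod_ballE.

End prod_metric.

Section hausdorff_dimension.
Context (R : realType) (T : metricType R).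
Implicit Types (A : set T) (s d : R).
Local Open Scope ereal_scope.

Definition diam A : \bar R :=
  maxe 0 (ereal_sup [set (mdist z.1 z.2)%:E | z in A `*` A]).

(* As usual 0 `^ 0 = 1 for nonempty [A], while the empty set always counts 0. *)
Definition diam_pow s A : \bar R := if A == set0 then 0 else diam A `^ s.

Definition hausdorff_premeasure s d A : \bar R :=
  ereal_inf [set \sum_(0 <= i <oo) diam_pow s (U i) |
    U in [set U : (set T)^nat |
      A `<=` \bigcup_i U i /\ forall i, diam (U i) <= d%:E]].

(* The premeasure is nonincreasing in [d], so the limit as d -> 0+ is a sup. *)
Definition hausdorff_measure s A : \bar R :=
  ereal_sup [set hausdorff_premeasure s d A | d in [set d | (0 < d)%R]].

Definition hausdorff_dim A : \bar R :=
  ereal_inf [set s%:E | s in [set s | (0 <= s)%R /\ hausdorff_measure s A = 0]].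

End hausdorff_dimension.

Section distribution_functions.
Context (R : realType) (X : metricType R) (f : X -> X).

Definition close_freq (x y : X) (e : R) (n : nat) : R :=
  n%:R^-1 * #|[pred i : 'I_n | mdist (iter i f x) (iter i f y) < e]|%:R.

Definition lower_distr (x y : X) (e : R) : R := limn_inf (close_freq x y e).

Definition upper_distr (x y : X) (e : R) : R := limn_sup (close_freq x y e).

Definition distr_lim_set (p q : R) : set (X * X) :=
  [set z | upper_distr z.1 z.2 e @[e --> 0^'+] --> q /\
           lower_distr z.1 z.2 e @[e --> 0^'+] --> p].

Definition distr_eq_set (p q : R) : set (X * X) :=
  [set z | exists e0 : R, 0 < e0 /\
     forall e, 0 < e <= e0 ->
       upper_distr z.1 z.2 e = q /\ lower_distr z.1 z.2 e = p].

End distribution_functions.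

(* Main.v *)
From Stdlib Require PeanoNat.
From HB Require Import structures.
Require Import Defs.
From mathcomp Require Import all_boot all_order all_algebra.
From mathcomp Require Import all_classical all_reals all_analysis.
From mathcomp Require Import ring lra zify.

(**
Upper bound. If [z = (x, y)] satisfies the limit condition then, for every block
length [L], the words of [x] and [y] agree on [[i, i + L)] for a proportion close
to [q] of the places [i < n], for infinitely many [n]. Inside one block of length
[L] such places form part of a final segment on which [x] and [y] agree, so there
are only [L + 1] shapes of agreement per block: the entropy of the shapes is
[O(log L / L)], and what remains are about [K ^ (n + (1 - q) n)] pairs of words of
length [n], which cover.

Lower bound. Let [y] coincide with [x] on a union of intervals of lengths tending
to infinity whose lower and upper densities are [p] and [q], let [y] be forced to
differ from [x] at one of every [m0] other places, and be free elsewhere. Such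
pairs satisfy the stronger condition, and reading the digits of a real
[t] in [[0, 1)] into the free letters parametrises them so that two parameters
whose pairs agree up to [n] are at distance at most [K ^ - (2 - q - 1 / m0) n].
Any cover thus induces a cover of [[0, 1)] by intervals, and Lebesgue measure is
subadditive.
*)

Set Implicit Arguments.
Unset Strict Implicit.
Unset Printing Implicit Defensive.

Import Order.TTheory GRing.Theory Num.Theory.
Import numFieldNormedType.Exports.

Local Open Scope classical_set_scope.
Local Open Scope ring_scope.

(** * Upper and lower limits of sequences in the unit interval *)

Section limsup_liminf.
Context (R : realType).
Implicit Types (u : R^nat) (l : R).

Lemma bounded_fun_unit u : (forall n, 0 <= u n <= 1) -> bounded_fun u.
Proof.
move=> u01; exists 1; split => // M M1 n _.
by have /andP[u0 u1] := u01 n; rewrite /= ger0_norm// (le_trans u1)// ltW.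
Qed.

Lemma limn_sup_frequently u l : (forall n, 0 <= u n <= 1) -> l < limn_sup u ->
  forall N, exists2 n, (N <= n)%N & l < u n.
Proof.
move=> u01 lu N; apply: contrapT => h; move: lu; apply/negP; rewrite -leNgt.
rewrite (limn_supE (bounded_fun_unit u01)).
have ge_l n : (N <= n)%N -> u n <= l.
  by move=> Nn; rewrite leNgt; apply/negP => lu; apply: h; exists n.
apply: (@le_trans _ _ (sups u N)).
  apply: ge_inf; last by exists N.
  exists 0 => _ [n _ <-]; have /andP[u0 _] := u01 n; apply: (le_trans u0).
  apply: ub_le_sup; last by exists n => /=.
  by exists 1 => _ [k _ <-]; have /andP[] := u01 k.
apply: ge_sup; first by exists (u N); exists N => /=.
by move=> _ [n /= Nn <-]; exact: ge_l.
Qed.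

Lemma limn_sup_eq u l : (forall n, 0 <= u n <= 1) ->
  (forall e, 0 < e -> exists N, forall n, (N <= n)%N -> u n <= l + e) ->
  (forall e, 0 < e -> forall N, exists2 n, (N <= n)%N & l - e <= u n) ->
  limn_sup u = l.
Proof.
move=> u01 ule leu; apply/eqP; rewrite eq_le; apply/andP; split.
  rewrite leNgt; apply/negP => lu.
  pose e := (limn_sup u - l) / 2.
  have e0 : 0 < e by rewrite divr_gt0// subr_gt0.
  have [N uN] := ule _ e0.
  have le_lim : l + e < limn_sup u by rewrite /e; lra.
  have [n Nn] := limn_sup_frequently u01 le_lim N.
  by apply/negP; rewrite -leNgt uN.
rewrite (limn_supE (bounded_fun_unit u01)).
apply: lb_le_inf; first by exists (sups u 0); exists 0%N.
move=> _ [N _ <-]; apply/ler_addgt0Pr => e e0.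
have [n Nn len] := leu _ e0 N; rewrite -lerBlDr; apply: (le_trans len).
apply: ub_le_sup; last by exists n.
by exists 1 => _ [k _ <-]; have /andP[] := u01 k.
Qed.

Lemma limn_inf_eq u l : (forall n, 0 <= u n <= 1) ->
  (forall e, 0 < e -> exists N, forall n, (N <= n)%N -> l - e <= u n) ->
  (forall e, 0 < e -> forall N, exists2 n, (N <= n)%N & u n <= l + e) ->
  limn_inf u = l.
Proof.
move=> u01 leu ule.
have hi : has_lbound (range u) by exists 0 => _ [n _ <-]; have /andP[] := u01 n.
rewrite (limn_infE (bounded_fun_unit u01)).
apply/eqP; rewrite eq_le; apply/andP; split.
  apply: ge_sup; first by exists (infs u 0); exists 0%N.
  move=> _ [N _ <-]; apply/ler_addgt0Pr => e e0.
  have [n Nn len] := ule _ e0 N; apply: le_trans len.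
  apply: ge_inf; last by exists n.
  by exists 0 => _ [k _ <-]; have /andP[] := u01 k.
apply/ler_addgt0Pr => e e0; have [N uN] := leu _ e0.
rewrite -lerBlDr; apply: (@le_trans _ _ (infs u N)).
  apply: lb_le_inf; first by exists (u N); exists N => /=.
  by move=> _ [n /= Nn <-]; exact: uN.
apply: ub_le_sup; last by exists N.
exists 1 => _ [n _ <-]; apply: (@le_trans _ _ (u n)); last by have /andP[] := u01 n.
apply: ge_inf; last by exists n => /=.
by exists 0 => _ [k _ <-]; have /andP[] := u01 k.
Qed.

End limsup_liminf.

(** * Small distances in the shift space as agreement of prefixes *)

Section shift_metric.
Context (R : realType) (K : nat).
Hypothesis K_gt1 : (1 < K)%N.
Implicit Types x y : fullshift R K.
Local Notation KR := (K%:R : R).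

Let KR_ge1 : 1 <= KR. Proof. by rewrite ler1n ltnW. Qed.
Let KR_gt0 : 0 < KR. Proof. by rewrite ltr0n ltnW. Qed.

Lemma mdist_fs_ge x y i : x i != y i -> KR ^- i <= mdist x y.
Proof.
move=> xyi; rewrite [mdist x y]/(fs_dist x y) /fs_dist.
case: pselect => [h|]; last by case; exists i.
case: ex_minnP => m _ /(_ _ xyi) mi.
by rewrite lef_pV2 ?posrE ?exprn_gt0// ler_weXn2l.
Qed.

Lemma mdist_fs_le x y m : (forall i, (i < m)%N -> x i = y i) ->
  mdist x y <= KR ^- m.
Proof.
move=> xy; rewrite [mdist x y]/(fs_dist x y) /fs_dist.
case: pselect => [h|_]; last by rewrite invr_ge0 exprn_ge0// ltW.
case: ex_minnP => k /eqP xyk _; have [km|mk] := ltnP k m; first by have := xy _ km.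
by rewrite lef_pV2 ?posrE ?exprn_gt0// ler_weXn2l.
Qed.

Lemma mdist_fs_lt x y m i : mdist x y < KR ^- m -> (i <= m)%N -> x i = y i.
Proof.
move=> xym im; apply/eqP/negPn/negP => /mdist_fs_ge xyi.
have := le_lt_trans xyi xym; apply/negP; rewrite -leNgt.
by rewrite lef_pV2 ?posrE ?exprn_gt0// ler_weXn2l.
Qed.

Lemma iter_fs_shift x n i : iter n (@fs_shift R K) x i = x (n + i)%N.
Proof.
by elim: n i => //= n IH i; rewrite /fs_shift IH addnS.
Qed.

Lemma Kinv_lt (e : R) : 0 < e -> exists m, KR ^- m < e.
Proof.
move=> e0.
have /cvgrPdist_lt /(_ _ e0)[m _ /(_ _ (leqnn m))] :
    (fun n => KR^-1 ^+ n) @ \oo --> (0 : R).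
  apply: cvg_expr; rewrite ger0_norm ?invr_ge0 ?ltW//.
  by rewrite invf_lt1// ltr1n.
rewrite /= sub0r normrN ger0_norm ?exprn_ge0 ?invr_ge0 ?ltW//.
by rewrite exprVn => mlt; exists m.
Qed.

End shift_metric.

(** * Monotonicity of Hausdorff measure and dimension *)

Section hausdorff_general.
Context (R : realType) (T : metricType R).
Implicit Types (A B : set T) (s d : R).
Local Open Scope ereal_scope.

Lemma diam_ge0 A : 0 <= diam A.
Proof. by rewrite /diam le_max lexx. Qed.

Lemma diam_pow_ge0 s A : 0 <= diam_pow s A.
Proof. by rewrite /diam_pow; case: ifP => // _; exact: poweR_ge0. Qed.

Lemma diam_ge A x y : A x -> A y -> (mdist x y)%:E <= diam A.
Proof.
move=> Ax Ay; rewrite /diam le_max; apply/orP; right.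
by apply: ereal_sup_ubound; exists (x, y).
Qed.

Lemma diam_le A d : (0 <= d)%R -> (forall x y, A x -> A y -> (mdist x y <= d)%R) ->
  diam A <= d%:E.
Proof.
move=> d0 Ad; rewrite /diam ge_max lee_fin d0/=.
by apply: ge_ereal_sup => _ [[x y] [/= Ax Ay] <-]; rewrite lee_fin Ad.
Qed.

Lemma diam_pow_le s A d : (0 < s)%R -> (0 <= d)%R -> diam A <= d%:E ->
  diam_pow s A <= (d `^ s)%:E.
Proof.
move=> s0 d0 Ad; rewrite /diam_pow; case: ifP => _.
  by rewrite lee_fin powR_ge0.
rewrite -poweR_EFin; apply: gt0_ler_poweR => //; first exact: ltW.
  by rewrite in_itv/= diam_ge0 leey.
by rewrite in_itv/= lee_fin d0 leey.
Qed.

Lemma hausdorff_premeasure_ge0 s d A : 0 <= hausdorff_premeasure s d A.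
Proof.
apply: le_ereal_inf_tmp => _ [U _ <-]; apply: nneseries_ge0 => i _ _.
exact: diam_pow_ge0.
Qed.

Lemma hausdorff_measure_ge0 s A : 0 <= hausdorff_measure s A.
Proof.
apply: (le_trans (hausdorff_premeasure_ge0 s 1%R A)).
by apply: ereal_sup_ubound; exists 1%R => //=.
Qed.

Lemma le_hausdorff_measure s A B : A `<=` B ->
  hausdorff_measure s A <= hausdorff_measure s B.
Proof.
move=> AB; apply: ge_ereal_sup => _ [d d0 <-].
apply: (@le_trans _ _ (hausdorff_premeasure s d B)); last first.
  by apply: ereal_sup_ubound; exists d.
apply: ereal_inf_le_tmp => _ [U [BU Ud] <-]; exists U => //; split => //.
exact: subset_trans BU.
Qed.

Lemma le_hausdorff_dim A B : A `<=` B -> hausdorff_dim A <= hausdorff_dim B.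
Proof.
move=> AB; apply: ereal_inf_le_tmp => _ [s [s0 Bs] <-]; exists s => //; split => //.
by apply/eqP; rewrite eq_le hausdorff_measure_ge0 andbT -Bs le_hausdorff_measure.
Qed.

End hausdorff_general.

(** * Covers indexed by countable types *)

Section covering.
Context (R : realType) (T : metricType R).
Local Open Scope ereal_scope.

(** [pickle] enumerates the index type; numbers that code no index receive [set0], which [diam_pow]
    counts as 0 for every exponent. *)
Lemma hausdorff_premeasure_le_cover s d (A : set T) (I : countType) (V : I -> set T) :
  A `<=` \bigcup_a V a -> (forall a, diam (V a) <= d%:E) -> (0 <= d)%R ->
  hausdorff_premeasure s d A <= \esum_(a in [set: I]) diam_pow s (V a).
Proof.
move=> AV Vd d0.
pose U (n : nat) : set T := if @pickle_inv I n is Some a then V a else set0.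
apply: (@le_trans _ _ (\sum_(0 <= i <oo) diam_pow s (U i))).
  apply: ereal_inf_lbound; exists U => //; split.
    move=> x /AV[a _ Vax]; exists (pickle a) => //.
    by rewrite /U pickleK_inv.
  move=> n; rewrite /U; case: pickle_inv => [a|]; first exact: Vd.
  by apply: diam_le.
rewrite nneseries_esumT; last by move=> n; exact: diam_pow_ge0.
have -> : \esum_(a in [set: I]) diam_pow s (V a) =
    \esum_(a in [set: I]) diam_pow s (U (pickle a)).
  by apply: eq_esum => a _; rewrite /U pickleK_inv.
rewrite -(@esum_image _ _ _ _ pickle (fun n => diam_pow s (U n))); last first.
  move=> a b _ _; exact: (pcan_inj pickleK_inv).
rewrite [leRHS]esum_mkcond; apply: le_esum => n _.
case: ifPn => //; rewrite notin_setE /= => h.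
have -> : U n = set0.
  rewrite /U; case E : (pickle_inv n) => [a|//].
  exfalso; apply: h; exists a => //.
  by have := @pickle_invK I n; rewrite /oapp E.
by rewrite /diam_pow eqxx.
Qed.

Lemma hausdorff_premeasure_le_nneseries s d (A : set T) (I : nat -> finType)
    (V : forall k, I k -> set T) : (0 <= d)%R ->
  (forall x, A x -> exists k (a : I k), V k a x) ->
  (forall k a, diam (V k a) <= d%:E) ->
  hausdorff_premeasure s d A <= \sum_(0 <= k <oo) \sum_(a : I k) diam_pow s (V k a).
Proof.
move=> d0 AV Vd.
pose W (a : {k & I k}) := V (tag a) (tagged a).
apply: (le_trans (@hausdorff_premeasure_le_cover s d A _ W _ _ d0)).
- by move=> x /AV[k [a Vx]]; exists (Tagged I a).
- by move=> [k a]; exact: Vd.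
pose J k : set {k & I k} := (fun i : I k => Tagged I i) @` [set: I k].
have -> : [set: {k & I k}] = \bigcup_k J k.
  by apply/seteqP; split => // -[k i] _; exists k => //; exists i.
rewrite nneseries_sum_bigcup.
- apply: lee_nneseries => k _ => [_|].
    by apply: esum_ge0 => a _; exact: diam_pow_ge0.
  rewrite /J esum_image; last by move=> i j _ _ /eqP; rewrite eq_Tagged => /eqP.
  rewrite esum_fset//; last by move=> i _; exact: diam_pow_ge0.
  rewrite (fsbigE (index_enum (I k)))//.
  + by rewrite (eq_bigl xpredT)// => i; apply: mem_set.
  + exact: index_enum_uniq.
  + by move=> i _; rewrite mem_index_enum.
  + exact: finite_finset.
- by move=> i j _ _ [_ [[a _ <-] [b _]]] /(congr1 tag).
- by move=> a; exact: diam_pow_ge0.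
Qed.

End covering.

(** * Counting agreement inside blocks *)

Lemma card_ord_pred (C : pred nat) n :
  #|[pred i : 'I_n | C i]| = (\sum_(0 <= i < n) C i)%N.
Proof. by rewrite -sum1_card big_mkcond/= big_mkord. Qed.

(** Provides the block length at which the [L + 1] shapes of agreement are outweighed by an
    exponential gain. With [b = a ^ (d / 2)], Bernoulli's inequality bounds [b ^ L] below linearly,
    hence its square quadratically. *)
Lemma linear_le_powR (R : realType) (a d : R) : 1 < a -> 0 < d ->
  exists2 L, (0 < L)%N & L.+1%:R * a `^ (- (L%:R * d)) <= 2^-1.
Proof.
move=> a1 d0; have a0 : 0 < a by lra.
have [b b1 powE] : exists2 b, 1 < b &
    forall n, a `^ (- (n%:R * d)) = (b ^+ n * b ^+ n)^-1.
  exists (a `^ (d / 2)).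
    by rewrite -(powRr0 a) /powR gt_eqF// mul0r ltr_expR mulr_gt0 ?divr_gt0// ln_gt0.
  move=> n; rewrite powRN; congr (_^-1).
  rewrite -powR_mulrn ?powR_ge0// -powRrM -powRD; last first.
    by rewrite (gt_eqF a0)/= implybT.
  by congr (_ `^ _); field.
have b0 : 0 < b by lra.
have bn n : 1 + n%:R * (b - 1) <= b ^+ n.
  elim: n => [|n IH]; first by rewrite mul0r addr0 expr0.
  rewrite exprS; apply: (@le_trans _ _ (b * (1 + n%:R * (b - 1)))); last first.
    by rewrite ler_wpM2l// ltW.
  rewrite -subr_ge0 -natr1.
  have -> : b * (1 + n%:R * (b - 1)) - (1 + (n%:R + 1) * (b - 1)) =
    n%:R * (b - 1) ^+ 2 by ring.
  by rewrite mulr_ge0// sqr_ge0.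
have bb : 0 < (b - 1) ^+ 2 by rewrite exprn_gt0// subr_gt0.
have [L L0 hL] : exists2 L, (0 < L)%N & 4 / (b - 1) ^+ 2 <= L%:R.
  by exists (Num.truncn (4 / (b - 1) ^+ 2)).+1 => //; exact/ltW/truncnS_gt.
exists L => //; rewrite powE.
have L1 : 1 <= L%:R :> R by rewrite ler1n.
have hL' : 4 <= L%:R * (b - 1) ^+ 2 by rewrite -ler_pdivrMr.
have h := bn L.
have bL : 0 < b ^+ L by rewrite exprn_gt0.
rewrite ler_pdivrMr ?mulr_gt0// -natr1.
move: (b ^+ L) (L%:R) h bL hL' L1 => B n h bL hL' L1 {hL}.
have nb : 0 <= n * (b - 1) by rewrite mulr_ge0//; lra.
have : (n * (b - 1)) * (n * (b - 1)) <= B * B by apply: ler_pM => //; lra.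
have -> : (n * (b - 1)) * (n * (b - 1)) = n * (n * (b - 1) ^+ 2) by ring.
have : n * 4 <= n * (n * (b - 1) ^+ 2) by rewrite ler_wpM2l//; lra.
lra.
Qed.

Section block_weight.
Context (R : realType) (K L : nat).
Hypothesis K_gt0 : (0 < K)%N.
Local Notation KR := (K%:R : R).
Local Notation block := {ffun 'I_L -> 'I_K * 'I_K}.

(* The term of index [m] is nonzero iff the two words of the block agree from
   position [m] on, and it is then [K ^ (L - m)]. *)
Definition block_weight (b : block) : R :=
  \sum_(m < L.+1) \prod_(r < L)
    (if (m <= r)%N then KR * ((b r).1 == (b r).2)%:R else 1).

(** Each index [m] contributes [K ^ (2 L)]: a position before [m] admits [K ^ 2] pairs of letters of
    weight 1, a position from [m] on admits [K] equal pairs of weight [K]. *)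
Lemma sum_block_weight : \sum_b block_weight b = L.+1%:R * (KR ^+ (2 * L)).
Proof.
rewrite exchange_big/= (eq_bigr (fun=> KR ^+ (2 * L))).
  by rewrite sumr_const card_ord mulr_natl.
move=> m _.
transitivity (\prod_(r < L) \sum_(c : 'I_K * 'I_K)
    if (m <= r)%N then KR * (c.1 == c.2)%:R else 1).
  by rewrite bigA_distr_bigA.
rewrite (eq_bigr (fun=> KR ^+ 2)).
  by rewrite prodr_const card_ord -exprM.
move=> r _; case: (boolP (m <= r)%N) => _; last first.
  by rewrite sumr_const card_prod !card_ord natrM expr2.
rewrite -mulr_sumr expr2; congr (_ * _).
rewrite -(pair_big xpredT xpredT (fun i j : 'I_K => (i == j)%:R))/=.
rewrite (eq_bigr (fun=> 1)); first by rewrite sumr_const card_ord.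
move=> i _; rewrite (bigD1 i)//= eqxx big1 ?addr0// => j.
by rewrite eq_sym => /negbTE ->.
Qed.

(** Only the term of the least element [m] of [C] is kept: the words agree from there on, so it
    equals [K ^ (L - m)], and [C] lies in the last [L - m] positions. For empty [C] the index is
    [L]. *)
Lemma block_weight_ge (b : block) (C : pred 'I_L) :
  (forall r s : 'I_L, C r -> (r <= s)%N -> (b s).1 = (b s).2) ->
  KR ^+ #|C| <= block_weight b.
Proof.
move=> hC.
have KR1 : 1 <= KR by rewrite ler1n.
have [m hm hCm] : exists2 m : 'I_L.+1, (forall r : 'I_L, C r -> (m <= r)%N) &
    forall s : 'I_L, (m <= s)%N -> (b s).1 = (b s).2.
  have [[r Cr]|noC] := pselect (exists r, C r); last first.
    exists ord_max => [r Cr|s /=]; first by case: noC; exists r.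
    by rewrite leqNgt ltn_ord.
  pose m := [arg min_(i < r | C i) (i : nat)].
  have [Cm hm] : C m /\ forall j, C j -> (m <= j)%N.
    by rewrite /m; case: arg_minnP.
  by exists (widen_ord (leqnSn L) m) => s /=; [exact: hm|exact: hC Cm].
rewrite /block_weight (bigD1 m)//= -[leLHS]addr0 lerD//; last first.
  apply: sumr_ge0 => i _; apply: prodr_ge0 => r _.
  by case: ifP => // _; rewrite mulr_ge0.
rewrite -prodr_const big_mkcond/=; apply: ler_prod => r _.
case: ifPn => [Cr|_].
  by rewrite hm// (hCm _ (hm _ Cr)) eqxx mulr1 lexx (le_trans _ KR1).
rewrite ler01/=; case: ifPn => // mr.
by rewrite hCm// eqxx mulr1.
Qed.

End block_weight.

Lemma close_freq_unit (R : realType) (X : metricType R) (f : X -> X) x y e n :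
  0 <= close_freq f x y e n <= 1.
Proof.
rewrite /close_freq mulr_ge0 ?invr_ge0//=.
case: n => [|n]; first by rewrite invr0 mul0r ler01.
rewrite mulrC ler_pdivrMr ?ltr0n// mul1r ler_nat.
by rewrite (leq_trans (max_card _))// card_ord.
Qed.

(** * Upper bound: covers by cylinders of heavy words *)

Section upper_bound.
Context (R : realType) (K : nat).
Hypothesis K_gt1 : (1 < K)%N.
Local Notation KR := (K%:R : R).
Local Notation S := (fullshift R K).

Let K_gt0 : (0 < K)%N. Proof. exact: ltnW. Qed.
Let KR_gt0 : 0 < KR. Proof. by rewrite ltr0n. Qed.
Let KR_ge1 : 1 <= KR. Proof. by rewrite ler1n. Qed.

Section blocks.
Context (L : nat).
Hypothesis L_gt0 : (0 < L)%N.
Local Notation block := {ffun 'I_L -> 'I_K * 'I_K}.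

Definition block_word k (z : S * S) : {ffun 'I_k -> block} :=
  [ffun j : 'I_k => [ffun r : 'I_L => (z.1 (j * L + r)%N, z.2 (j * L + r)%N)]].

Lemma diam_block_word k (w : {ffun 'I_k -> block}) :
  (diam [set z | block_word k z = w] <= (KR ^- (k * L))%:E)%E.
Proof.
apply: diam_le; first by rewrite invr_ge0 exprn_ge0// ltW.
move=> z z' /= zw z'w; rewrite [mdist z z']/(prod_dist z z') /prod_dist.
have eq_zz' i : (i < k * L)%N -> z.1 i = z'.1 i /\ z.2 i = z'.2 i.
  move=> ikL; have iL : (i %/ L < k)%N by rewrite ltn_divLR.
  have rL : (i %% L < L)%N by rewrite ltn_mod.
  have : block_word k z (Ordinal iL) (Ordinal rL) =
    block_word k z' (Ordinal iL) (Ordinal rL) by rewrite zw z'w.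
  by rewrite !ffunE/= -divn_eq => -[-> ->].
by rewrite ge_max; apply/andP; split; apply: mdist_fs_le => // i /eq_zz'[].
Qed.

(** A place in [C] starts an agreement of length [L], which reaches the end of the block containing
    that place; so [block_weight_ge] applies in each block. *)
Lemma prod_block_weight_ge k (z : S * S) (C : pred nat) :
  (forall i j, C i -> (i <= j < i + L)%N -> z.1 j = z.2 j) ->
  KR ^+ (\sum_(0 <= i < k * L) C i) <=
  \prod_(j < k) block_weight R (block_word k z j).
Proof.
move=> hC; rewrite expr_sum big_nat_mul big_mkord.
apply: ler_prod => j _; rewrite prodr_ge0/=; last by move=> *; rewrite exprn_ge0// ltW.
have -> : \prod_(j * L <= i < j.+1 * L) KR ^+ C i =
    KR ^+ #|[pred r : 'I_L | C (j * L + r)%N]|.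
  rewrite (card_ord_pred (fun r => C (j * L + r)%N)) expr_sum.
  rewrite mulSn -{1}[(j * L)%N]add0n big_addn addnK.
  by apply: eq_bigr => r _; rewrite addnC.
apply: block_weight_ge => // r s /= Cr rs; rewrite ffunE ffunE/=.
by apply: (hC _ _ Cr); have := ltn_ord s; lia.
Qed.

Lemma sum_prod_block_weight k :
  \sum_(w : {ffun 'I_k -> block}) \prod_(j < k) block_weight R (w j) =
  (L.+1%:R * KR ^+ (2 * L)) ^+ k.
Proof.
rewrite -(@sum_block_weight R K L) -[in RHS](card_ord k) -prodr_const.
by rewrite bigA_distr_bigA.
Qed.

End blocks.

Lemma block_weight_prod_ge1 L k (w : {ffun 'I_k -> {ffun 'I_L -> 'I_K * 'I_K}}) :
  1 <= \prod_(j < k) block_weight R (w j).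
Proof.
apply: (big_ind (fun x => 1 <= x)) => // [x y x1 y1|j _]; first by rewrite mulr_ege1.
by rewrite -[leLHS](expr0 KR) -(@card0 'I_L); apply: block_weight_ge.
Qed.

Variables q d : R.
Hypothesis d_gt0 : 0 < d.

Section cover.
Context (L : nat).
Hypothesis L_gt0 : (0 < L)%N.
Local Notation word k := {ffun 'I_k -> {ffun 'I_L -> 'I_K * 'I_K}}.

(** Light words get the empty set, so that sums can run over all words of a given length. *)
Definition heavy_cylinder k (w : word k) : set (S * S) :=
  if KR `^ ((q - d) * (k * L)%:R) <= \prod_(j < k) block_weight R (w j)
  then [set z | block_word L k z = w] else set0.

Lemma diam_heavy_cylinder k (w : word k) :
  (diam (heavy_cylinder w) <= (KR ^- (k * L))%:E)%E.
Proof.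
rewrite /heavy_cylinder; case: ifP => _; first exact: diam_block_word.
by apply: diam_le => //; rewrite invr_ge0 exprn_ge0// ltW.
Qed.

(** Markov's inequality: the number of heavy words is controlled by the total weight
    [((L + 1) K ^ (2 L)) ^ k] of all words. The exponent [2 - q + 2 d] leaves a factor
    [(L + 1) K ^ (- L d)] for each block. *)
Lemma sum_diam_heavy_cylinder k : 0 < 2 - q + 2 * d ->
  L.+1%:R * KR `^ (- (L%:R * d)) <= 2^-1 ->
  (\sum_(w : word k) diam_pow (2 - q + 2 * d) (heavy_cylinder w) <=
   (2^-1 ^+ k)%:E)%E.
Proof.
move=> s0 L_large; set s := 2 - q + 2 * d.
(* [a] is the diameter bound raised to the power [s], divided by the threshold of heaviness. *)
pose a := KR `^ (- ((q - d + s) * (k * L)%:R)).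
apply: (@le_trans _ _ (\sum_(w : word k)
    (a * \prod_(j < k) block_weight R (w j))%:E)%E).
  apply: lee_sum => w _.
  have W1 := block_weight_prod_ge1 w.
  have [wt|wt] := leP (KR `^ ((q - d) * (k * L)%:R))
      (\prod_(j < k) block_weight R (w j)); last first.
    rewrite /heavy_cylinder ifF; last by apply/negbTE; rewrite -ltNge.
    rewrite /diam_pow eqxx lee_fin mulr_ge0 ?powR_ge0//.
    exact: le_trans W1.
  apply: (le_trans (diam_pow_le s0 _ (diam_heavy_cylinder w))).
    by rewrite invr_ge0 exprn_ge0// ltW.
  rewrite lee_fin; apply: le_trans (ler_wpM2l _ wt); last exact: powR_ge0.
  rewrite /a -powRD; last by rewrite (gt_eqF KR_gt0)/= implybT.
  rewrite -powR_invn ?(ltW KR_gt0)// -powRrM.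
  by apply: ler_powR => //; rewrite le_eqVlt; apply/orP; left; apply/eqP;
    rewrite /s; ring.
rewrite sumEFin lee_fin -mulr_sumr sum_prod_block_weight.
have -> : a * (L.+1%:R * KR ^+ (2 * L)) ^+ k =
    (L.+1%:R * KR `^ (- (L%:R * d))) ^+ k.
  have -> : a = KR `^ (- ((q - d + s) * L%:R)) ^+ k.
    rewrite -powR_mulrn ?powR_ge0// -powRrM /a.
    by congr (_ `^ _); rewrite natrM; ring.
  rewrite -exprMn; congr (_ ^+ _).
  rewrite mulrCA; congr (_ * _).
  rewrite -powR_mulrn ?(ltW KR_gt0)// -powRD; last by rewrite (gt_eqF KR_gt0)/= implybT.
  by congr (_ `^ _); rewrite natrM /s; ring.
by rewrite lerXn2r ?nnegrE ?mulr_ge0 ?powR_ge0 ?invr_ge0.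
Qed.

(** For small [e], closeness forces agreement on a window covering [L] places, and arbitrarily long
    prefixes have a proportion of close places above [q - d / 2]. Rounding their length down to a
    multiple of [L] costs at most another [d / 2]. *)
Lemma mem_heavy_cylinder (p : R) z : distr_lim_set (@fs_shift R K) p q z ->
  forall k0, exists k (w : word (k0 + k)), heavy_cylinder w z.
Proof.
move=> [zq _] k0.
have [e [e0 eL] hq] : exists2 e, 0 < e /\ e <= KR ^- L &
    q - d / 2 < upper_distr (@fs_shift R K) z.1 z.2 e.
  have KL0 : 0 < KR ^- L by rewrite invr_gt0 exprn_gt0.
  near (0 : R)^'+ => e; exists e; first split.
  - by near: e; exact: nbhs_right_gt.
  - by near: e; exact: nbhs_right_le.
  - by near: e; apply: (cvgr_gt _ zq); rewrite gtrBl divr_gt0.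
pose C i := mdist (iter i (@fs_shift R K) z.1) (iter i (@fs_shift R K) z.2) < e.
pose cnt n := (\sum_(0 <= i < n) C i)%N.
have agree i j : C i -> (i <= j < i + L)%N -> z.1 j = z.2 j.
  move=> Ci ij.
  have := @mdist_fs_lt R K K_gt1 _ _ L (j - i) (lt_le_trans Ci eL).
  by rewrite !iter_fs_shift subnKC; [apply; lia|lia].
suff [k kk0 kC] : exists2 k, (k0 <= k)%N & (q - d) * (k * L)%:R <= (cnt (k * L)%N)%:R.
  exists (k - k0)%N; rewrite subnKC//; exists (block_word L k z).
  rewrite /heavy_cylinder ifT//.
  have ge := @prod_block_weight_ge L L_gt0 k z C agree.
  apply: le_trans ge.
  by rewrite -powR_mulrn ?(ltW KR_gt0)// ler_powR.
(* A nonpositive threshold is met by any count; otherwise [q - d / 2] is positive, as the final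
   comparison of [k * L] with [n] requires. *)
have [qd|qd] := leP (q - d) 0.
  exists k0 => //; apply: (@le_trans _ _ 0) => //.
  by rewrite mulr_le0_ge0.
(* With at least [2 / d] blocks, the fewer than [L] places lost by rounding are at most a share
   [d / 2] of [k * L]. *)
pose k1 := maxn k0 (Num.truncn (2 / d)).+1.
have [n kn hn] := limn_sup_frequently (close_freq_unit _ _ _ _) hq (k1.+1 * L).
have L1 : 1 <= L%:R :> R by rewrite ler1n.
pose k := (n %/ L)%N.
have k1k : (k1 <= k)%N by rewrite leq_divRL// (leq_trans _ kn)// leq_mul2r leqnSn orbT.
have nE : n = (k * L + n %% L)%N by exact: divn_eq.
exists k; first by rewrite (leq_trans _ k1k)// leq_maxl.
have n0 : (0 < n)%N by apply: leq_trans kn; rewrite muln_gt0.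
move: hn; rewrite /close_freq -/C.
rewrite (card_ord_pred C) -/(cnt n) ltr_pdivlMl ?ltr0n// => hn.
have cntn : (cnt n <= cnt (k * L) + L)%N.
  rewrite {1}nE /cnt (@big_cat_nat _ _ _ (k * L)%N) ?leq_addr//= leq_add2l.
  apply: (@leq_trans (\sum_(k * L <= i < k * L + n %% L) 1)%N).
    by apply: leq_sum => i _; exact: leq_b1.
  by rewrite sum_nat_const_nat muln1 addKn ltnW// ltn_mod.
have dk : L%:R <= d / 2 * (k * L)%:R :> R.
  rewrite natrM mulrA ler_peMl//.
  have : 2 / d <= k%:R.
    apply: (@le_trans _ _ (Num.truncn (2 / d)).+1%:R); first exact/ltW/truncnS_gt.
    by rewrite ler_nat (leq_trans _ k1k)// leq_maxr.
  by rewrite ler_pdivrMr// => ?; lra.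
have kLn : (k * L)%:R <= n%:R :> R by rewrite ler_nat [leqRHS]nE leq_addr.
move: cntn; rewrite -(ler_nat R) natrD => cntn.
have : (q - d / 2) * (k * L)%:R <= (q - d / 2) * n%:R.
  by rewrite ler_wpM2l//; have := d_gt0; lra.
move: hn cntn dk; set x := (k * L)%:R; set y := n%:R; set u := (cnt n)%:R.
set v := (cnt _)%:R => hn cntn dk h.
have -> : (q - d) * x = (q - d / 2) * x - d / 2 * x by field.
lra.
Unshelve. all: by end_near. Qed.

End cover.

End upper_bound.

(** * Vanishing of the Hausdorff measure above [2 - q] *)

Section upper_dim.
Context (R : realType) (K : nat).
Hypothesis K_gt1 : (1 < K)%N.
Variables p q : R.
Hypothesis q_le1 : q <= 1.
Local Notation KR := (K%:R : R).
Local Open Scope ereal_scope.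

Lemma nneseries_half k0 :
  \sum_(0 <= k <oo) (2^-1 ^+ (k0 + k) : R)%:E <= (2 * 2 ^- k0 : R)%:E.
Proof.
apply: lime_le.
  by apply: is_cvg_nneseries => k _ _; rewrite lee_fin exprn_ge0.
apply: nearW => n; rewrite sumEFin lee_fin.
have <- : (series (geometric (2 ^- k0) 2^-1) n =
    \sum_(0 <= i < n) 2^-1 ^+ (k0 + i) :> R)%R.
  by rewrite /series/=; apply: eq_bigr => i _; rewrite exprD -exprVn.
have -> : (2 * 2 ^- k0 = 2 ^- k0 * (1 - 2^-1)^-1 :> R)%R.
  by rewrite mulrC; congr (_ * _)%R; field.
by rewrite geometric_le_lim ?invr_ge0 ?exprn_ge0// ger0_norm ?invr_ge0// invf_lt1 ?ltr1n.
Qed.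

Lemma hausdorff_measure_distr_lim_set d : (0 < d)%R ->
  hausdorff_measure (2 - q + 2 * d)%R (distr_lim_set (@fs_shift R K) p q) = 0.
Proof.
move=> d0; have s0 : (0 < 2 - q + 2 * d)%R by have := q_le1; lra.
have KR_gt1 : (1 < KR)%R by rewrite ltr1n.
have KR_gt0 : (0 < KR)%R by rewrite ltr0n ltnW.
have [L L0 hL] := linear_le_powR KR_gt1 d0.
apply/eqP; rewrite eq_le hausdorff_measure_ge0 andbT.
apply: ge_ereal_sup => _ [e e0 <-].
apply/lee_addgt0Pr => r r0; rewrite add0e.
have [k1 hk1] := Kinv_lt K_gt1 e0.
have [k2 hk2] : exists k2, (2 ^- k2 < r / 2)%R.
  by apply: Kinv_lt; rewrite ?divr_gt0.
(* [k1] makes the diameters at most [e], and [k2] makes the geometric tail at most [r]. *)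
pose k0 := maxn k1 k2.
have := @hausdorff_premeasure_le_nneseries R _ (2 - q + 2 * d)%R e
  (distr_lim_set (@fs_shift R K) p q) _
  (fun k w => heavy_cylinder q d w (L := L) (k := (k0 + k)%N)).
move=> /(_ (ltW e0)) h; apply: (le_trans (h _ _)).
- by move=> z zE; have := mem_heavy_cylinder K_gt1 d0 L0 zE k0.
- move=> k w; apply: (le_trans (diam_heavy_cylinder K_gt1 _ _ L0 w)).
  rewrite lee_fin (le_trans _ (ltW hk1))// lef_pV2 ?posrE ?exprn_gt0//.
  rewrite ler_weXn2l ?(ltW KR_gt1)//.
  by rewrite (leq_trans (leq_maxl _ k2))// (leq_trans (leq_addr k _))// leq_pmulr.
apply: (@le_trans _ _ (\sum_(0 <= k <oo) (2^-1 ^+ (k0 + k) : R)%:E)).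
  apply: lee_nneseries => k _ => [_|]//.
    by apply: sume_ge0 => w _; exact: diam_pow_ge0.
  exact: sum_diam_heavy_cylinder.
apply: (le_trans (nneseries_half _)); rewrite lee_fin -ler_pdivlMl// mulrC.
apply: le_trans (ltW hk2); rewrite lef_pV2 ?posrE ?exprn_gt0// ler_weXn2l ?ler1n//.
exact: leq_maxr.
Qed.

Lemma hausdorff_dim_distr_lim_set_le :
  hausdorff_dim (distr_lim_set (@fs_shift R K) p q) <= (2 - q)%R%:E.
Proof.
apply/lee_addgt0Pr => e e0; apply: ereal_inf_lbound.
exists (2 - q + 2 * (e / 2))%R; last by rewrite -EFinD; congr (_%:E); field.
split => /=; first by have := q_le1; have := e0; lra.
by apply: hausdorff_measure_distr_lim_set; rewrite divr_gt0.
Qed.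

End upper_dim.

(** * Integer square roots *)

Local Notation sqrtn := PeanoNat.Nat.sqrt.

Lemma sqrtn_spec n : (sqrtn n ^ 2 <= n < (sqrtn n).+1 ^ 2)%N.
Proof.
have [] := PeanoNat.Nat.sqrt_spec n (PeanoNat.Nat.le_0_l n).
by rewrite -!mulnn; move=> h1 h2; apply/andP; split; apply/ssrnat.leP.
Qed.

Lemma sqrtn_eq n j : (j ^ 2 <= n < j.+1 ^ 2)%N -> sqrtn n = j.
Proof.
case/andP=> jn nj; have /andP[sn ns] := sqrtn_spec n.
apply/eqP; rewrite eqn_leq -ltnS -(@ltn_exp2r _ _ 2)// (leq_ltn_trans sn nj)/=.
by rewrite -ltnS -(@ltn_exp2r _ _ 2)// (leq_ltn_trans jn ns).
Qed.

Lemma leq_sqrtn m n : (m <= n)%N -> (sqrtn m <= sqrtn n)%N.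
Proof. by move=> /ssrnat.leP h; apply/ssrnat.leP; exact: PeanoNat.Nat.sqrt_le_mono. Qed.

Lemma sqrtn_add_leq n m : (sqrtn (n + m) <= sqrtn n + m)%N.
Proof.
rewrite -ltnS -(@ltn_exp2r _ _ 2)//.
have /andP[h _] := sqrtn_spec (n + m); apply: leq_ltn_trans h _.
have /andP[_] := sqrtn_spec n.
move: (sqrtn n) => s; rewrite -!mulnn; nia.
Qed.

(** Induction on [m]: raising the shift by one telescopes, adding [sqrtn (n + m) - sqrtn m]. *)
Lemma sum_sqrtn_add n m :
  (\sum_(0 <= i < n) sqrtn (i + m) <=
   \sum_(0 <= i < n) sqrtn i + m * sqrtn (n + m))%N.
Proof.
elim: m => [|m IH]; first by under eq_bigr do rewrite addn0; rewrite leq_addr.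
have shift : (\sum_(0 <= i < n) sqrtn (i + m.+1) + sqrtn m =
    \sum_(0 <= i < n) sqrtn (i + m) + sqrtn (n + m))%N.
  elim: n {IH} => [|n IH]; first by rewrite !big_geq.
  by rewrite !big_nat_recr//= addnAC IH addnS addSn; lia.
have : (sqrtn (n + m) <= sqrtn (n + m.+1))%N by apply: leq_sqrtn; lia.
have : (m * sqrtn (n + m) <= m * sqrtn (n + m.+1))%N.
  by rewrite leq_mul2l leq_sqrtn ?orbT//; lia.
by rewrite mulSn; lia.
Qed.

(** If [j = sqrtn n] is positive and at least [2 c / e], then
    [c (j + 1) <= 2 c j <= e j ^ 2 <= e n]. *)
Lemma sqrtn_little (R : realType) (c e : R) : 0 <= c -> 0 < e ->
  exists N, forall n, (N <= n)%N -> c * (sqrtn n + 1)%:R <= e * n%:R.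
Proof.
move=> c0 e0; pose j0 := (Num.truncn (2 * c / e)).+1.
exists (j0 ^ 2)%N => n jn.
have : (j0 <= sqrtn n)%N.
  by rewrite -(@sqrtn_eq (j0 ^ 2) j0) ?leq_sqrtn// leqnn ltn_exp2r/=.
have /andP[+ _] := sqrtn_spec n.
move: (sqrtn n) => j jn2 j0j.
have h0 : 2 * c / e <= j%:R.
  by apply: (@le_trans _ _ j0%:R); [exact/ltW/truncnS_gt|rewrite ler_nat].
have h1 : 2 * c <= e * j%:R by rewrite [leRHS]mulrC -ler_pdivrMr.
apply: (@le_trans _ _ (2 * c * j%:R)).
  rewrite [2 * c]mulrC -mulrA ler_wpM2l// -natrM ler_nat.
  by have : (0 < j0)%N by []; lia.
apply: (@le_trans _ _ (e * j%:R * j%:R)); first by rewrite ler_wpM2r.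
by rewrite -mulrA ler_wpM2l ?(ltW e0)// -natrM ler_nat mulnn.
Qed.

(** * A set of places with prescribed lower and upper densities *)

Section pattern.
Context (R : realType) (p q : R).
Hypothesis p_ge0 : 0 <= p.
Hypothesis p_le_q : p <= q.
Hypothesis q_le1 : q <= 1.

(* The block of squares [j ^ 2, (j + 1) ^ 2) has target density [q] or [p]; the
   target switches at the doubly exponential places [j = 2 ^ 2 ^ k]. *)
Definition target j : R := if odd (trunc_log 2 (trunc_log 2 j)) then q else p.

(** Greedy rounding: the running surplus at [j ^ 2] of chosen places over the target. Block [i], of
    length [2 i + 1], is filled entirely or left empty according to the sign. *)
Fixpoint excess j : R :=
  if j is i.+1 then excess i + ((excess i <= 0)%R%:R - target i) * (2 * i + 1)%:R
  else 0.

Definition pattern i : bool := excess (sqrtn i) <= 0.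

Definition target_sum n : R := \sum_(0 <= i < n) target (sqrtn i).

Lemma target_bounds j : p <= target j <= q.
Proof. by rewrite /target; case: ifP; rewrite ?lexx ?p_le_q. Qed.

(** A positive excess is never raised and any other never lowered, and a step is at most the block
    length [2 j + 1], so no step leaves the interval of that radius. *)
Lemma excess_le j : `|excess j| <= (2 * j + 1)%:R.
Proof.
elim: j => [|j IH]; first by rewrite normr0.
apply: (@le_trans _ _ (2 * j + 1)%:R); last by rewrite ler_nat; lia.
have /andP[t0 t1] := target_bounds j.
rewrite /=; set t := target j in t0 t1 *; set e := excess j in IH *.
move: IH; set n := (2 * j + 1)%:R; rewrite !ler_norml => /andP[h1 h2].
have n0 : 0 <= n by [].
have tn0 : 0 <= t * n by rewrite mulr_ge0// (le_trans p_ge0).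
have tn1 : t * n <= n by rewrite ler_piMl// (le_trans t1).
rewrite mulrBl; have [e0|e0] := leP e 0; rewrite ?mul1r ?mul0r; lra.
Qed.

Lemma sum_sqrtn_block (F : nat -> R) j n : (j ^ 2 <= n <= j.+1 ^ 2)%N ->
  \sum_(j ^ 2 <= i < n) F (sqrtn i) = F j *+ (n - j ^ 2).
Proof.
move=> jn; rewrite (eq_big_nat _ _ (F2 := fun=> F j)); last first.
  by move=> i ij; rewrite (@sqrtn_eq i j)//; lia.
by rewrite sumr_const_nat.
Qed.

Lemma excessE j :
  \sum_(0 <= i < j ^ 2) (pattern i)%:R - target_sum (j ^ 2) = excess j.
Proof.
rewrite /target_sum -sumrB.
pose F k : R := (excess k <= 0)%R%:R - target k.
rewrite -/(\sum_(0 <= i < j ^ 2) F (sqrtn i)).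
elim: j => [|j IH]; first by rewrite big_geq.
have jj : (j ^ 2 <= j.+1 ^ 2)%N by rewrite leq_exp2r.
have lenE : (j.+1 ^ 2 - j ^ 2 = 2 * j + 1)%N by rewrite -!mulnn; lia.
rewrite (@big_cat_nat _ _ _ (j ^ 2) 0 _ _ _ (leq0n _) jj).
rewrite IH (@sum_sqrtn_block F j _ _) ?jj ?leqnn// lenE.
by rewrite -[F j *+ _]mulr_natr.
Qed.

(** At most [2 j + 1] comes from the excess at the last square [j ^ 2], and at most [2 j] from the
    unfinished block after it. *)
Lemma pattern_sum_le n :
  `|\sum_(0 <= i < n) (pattern i)%:R - target_sum n| <= (4 * sqrtn n + 1)%:R.
Proof.
have := sqrtn_spec n; set j := sqrtn n => jn.
rewrite /target_sum -sumrB.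
pose F k : R := (excess k <= 0)%R%:R - target k.
have /andP[jn1 jn2] := jn.
rewrite (@big_cat_nat _ _ _ (j ^ 2) 0 _ _ _ (leq0n _) jn1).
rewrite sumrB -/(target_sum _) excessE.
rewrite -/(\sum_(j ^ 2 <= i < n) F (sqrtn i)) sum_sqrtn_block; last first.
  by case/andP: jn => -> /ltnW.
apply: (le_trans (ler_normD _ _)).
have F1 : `|F j| <= 1.
  have /andP[t0 t1] := target_bounds j.
  have := p_ge0; have := q_le1.
  by rewrite /F ler_norml; case: (excess j <= 0) => /=; lra.
apply: (@le_trans _ _ ((2 * j + 1)%:R + (2 * j)%:R)); last first.
  by rewrite -natrD ler_nat; lia.
apply: lerD; first exact: excess_le.
rewrite normrMn; apply: (@le_trans _ _ (1 *+ (n - j ^ 2))).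
  by rewrite ler_wMn2r.
by rewrite ler_nat; move: jn; rewrite -!mulnn; lia.
Qed.

Lemma target_sum_le n : target_sum n <= q * n%:R.
Proof.
rewrite /target_sum mulr_natr -[in leRHS](subn0 n) -sumr_const_nat.
by apply: ler_sum => i _; case/andP: (target_bounds (sqrtn i)).
Qed.

Lemma target_sum_ge n : p * n%:R <= target_sum n.
Proof.
rewrite /target_sum mulr_natr -[in leLHS](subn0 n) -sumr_const_nat.
by apply: ler_sum => i _; case/andP: (target_bounds (sqrtn i)).
Qed.

Lemma target_phase k j : (2 ^ 2 ^ k <= j < 2 ^ 2 ^ k.+1)%N ->
  target j = if odd k then q else p.
Proof.
case/andP=> kj jk; rewrite /target (@trunc_log_eq 2 k)//.
rewrite trunc_log_max//= -(@ltn_exp2l 2)//; apply: leq_ltn_trans jk.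
by rewrite trunc_logP// (leq_trans _ kj)// expn_gt0.
Qed.


(** Since [m] is the square of [2 ^ 2 ^ k], every place in [[m, m ^ 2)] has its root in phase [k],
    where the target is constant; the first [m] places cause an error of at most [m]. *)
Lemma target_sum_phase k m : m = (2 ^ 2 ^ k.+1)%N ->
  `|target_sum (m ^ 2) - (if odd k then q else p) * (m ^ 2)%:R| <= m%:R.
Proof.
set t := if odd k then q else p => mk.
have mE : (m = (2 ^ 2 ^ k) ^ 2)%N by rewrite mk -expnM -expnSr.
have m1 : (0 < m)%N by rewrite mk expn_gt0.
have mm : (m <= m ^ 2)%N by rewrite -mulnn leq_pmulr.
have -> : target_sum (m ^ 2) = target_sum m + t * (m ^ 2 - m)%:R.
  rewrite {1}/target_sum (@big_cat_nat _ _ _ m 0 _ _ _ (leq0n _) mm).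
  congr (_ + _); rewrite mulr_natr -sumr_const_nat.
  apply: eq_big_nat => i /andP[mi im]; apply: target_phase.
  have /andP[s1 s2] := sqrtn_spec i.
  rewrite -ltnS -(@ltn_exp2r _ _ 2)// -mE (leq_ltn_trans mi s2)/=.
  by rewrite -(@ltn_exp2r _ _ 2)// (leq_ltn_trans s1)// -mk.
have /andP[t0 t1] : 0 <= t <= 1.
  by rewrite /t; case: ifP => _; have := p_ge0; have := p_le_q; have := q_le1; lra.
have T0 : 0 <= target_sum m.
  by apply: (le_trans _ (target_sum_ge m)); rewrite mulr_ge0.
have T1 : target_sum m <= m%:R.
  by apply: (le_trans (target_sum_le m)); rewrite ler_piMl.
have tm0 : 0 <= t * m%:R by rewrite mulr_ge0.
have tm1 : t * m%:R <= m%:R by rewrite ler_piMl.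
by rewrite natrB// ler_norml; lra.
Qed.

(** The deviation is [o(n)], so [cnt] inherits the behaviour of [target_sum], which lies between
    [p n] and [q n] and comes within [o(n)] of [q n] at the ends of odd phases and of [p n] at the
    ends of even ones. *)
Lemma limits_pattern_like (cnt : nat -> nat) (c : R) : 0 <= c ->
  (forall n, 0 <= (n%:R^-1 : R) * (cnt n)%:R <= 1) ->
  (forall n, `|(cnt n)%:R - target_sum n| <= c * (sqrtn n + 1)%:R) ->
  limn_sup (fun n => (n%:R^-1 : R) * (cnt n)%:R) = q /\
  limn_inf (fun n => (n%:R^-1 : R) * (cnt n)%:R) = p.
Proof.
move=> c0 u01 cntT.
have near_target e : 0 < e -> exists N, forall n, (N <= n)%N ->
    (0 < n)%N /\ `|(cnt n)%:R - target_sum n| <= e * n%:R.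
  move=> e0; have [N hN] := sqrtn_little c0 e0.
  exists N.+1 => n Nn; split; first exact: leq_ltn_trans Nn.
  by apply: (le_trans (cntT n)); apply: hN; exact: ltnW.
have phase e b : 0 < e -> forall N, exists2 n, (N <= n)%N &
    `|n%:R^-1 * (cnt n)%:R - (if b then q else p)| <= e.
  move=> e0 N; have e20 : 0 < e / 2 by rewrite divr_gt0.
  have [N1 hN1] := near_target _ e20.
  pose k0 := maxn (maxn N N1) (Num.truncn (2 / e)).+1.
  (* The parity of the phase selects [q] or [p]. *)
  pose k := if odd k0 == b then k0 else k0.+1.
  have kb : odd k = b.
    by rewrite /k; case: (eqVneq (odd k0) b) => //= ; case: (odd k0); case: (b).
  have k0k : (k0 <= k)%N by rewrite /k; case: ifP.
  pose m := (2 ^ 2 ^ k.+1)%N.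
  have km : (k < m)%N.
    apply: (ltn_trans (ltnSn k)); apply: (ltn_trans (ltn_expl _ (ltnSn 1))).
    exact: ltn_expl.
  have mm : (m <= m ^ 2)%N by rewrite -mulnn leq_pmulr// (leq_ltn_trans _ km).
  have Nm : (maxn N N1 <= m ^ 2)%N.
    by rewrite (leq_trans _ mm)// (leq_trans _ (ltnW km))// (leq_trans _ k0k)// leq_maxl.
  exists (m ^ 2)%N; first by rewrite (leq_trans _ Nm)// leq_maxl.
  have [n0 h1] := hN1 _ (leq_trans (leq_maxr _ _) Nm).
  have := @target_sum_phase k m erefl; rewrite kb => h2.
  have m_small : m%:R <= e / 2 * (m ^ 2)%:R.
    rewrite -mulnn natrM mulrA ler_peMl// mulrC -ler_pdivrMr// mul1r invf_div.
    apply: (@le_trans _ _ (Num.truncn (2 / e)).+1%:R); first exact/ltW/truncnS_gt.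
    by rewrite ler_nat (leq_trans _ (ltnW km))// (leq_trans _ k0k)// leq_maxr.
  move: h1 h2 m_small n0; move: (m ^ 2)%N => n; move: (if b then q else p) => t.
  move=> h1 h2 hm n0; have n0' : 0 < n%:R :> R by rewrite ltr0n.
  rewrite -(ler_pM2r n0') -[X in _ * X <= _](gtr0_norm n0') -normrM.
  rewrite mulrBl mulrAC mulVf ?gt_eqF// mul1r.
  have -> : (cnt n)%:R - t * n%:R =
      ((cnt n)%:R - target_sum n) + (target_sum n - t * n%:R).
    by ring.
  apply: (le_trans (ler_normD _ _)); apply: (le_trans (lerD h1 (le_trans h2 hm))).
  by rewrite le_eqVlt; apply/orP; left; apply/eqP; field.
split.
  apply: limn_sup_eq => // e e0.
    have [N hN] := near_target _ e0; exists N => n /hN[n0].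
    rewrite ler_norml => /andP[_ h]; have n0' : 0 < n%:R :> R by rewrite ltr0n.
    rewrite mulrC ler_pdivrMr// mulrDl.
    by have := target_sum_le n; lra.
  move=> N; have [n Nn h] := phase e true e0 N; exists n => //.
  by move: h; rewrite ler_norml => /andP[]; lra.
apply: limn_inf_eq => // e e0.
  have [N hN] := near_target _ e0; exists N => n /hN[n0].
  rewrite ler_norml => /andP[h _]; have n0' : 0 < n%:R :> R by rewrite ltr0n.
  rewrite mulrC ler_pdivlMr// mulrBl.
  by have := target_sum_ge n; lra.
move=> N; have [n Nn h] := phase e false e0 N; exists n => //.
by move: h; rewrite ler_norml => /andP[]; lra.
Qed.

End pattern.

(** * Pairs of sequences built from a sequence of digits *)

Lemma ordS_neq K (c : 'I_K) : (1 < K)%N -> ordS c != c.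
Proof.
move=> K1; apply/eqP => /(congr1 val) /=.
have [lt|ge] := ltnP c.+1 K; first by rewrite modn_small//; lia.
have -> : c.+1 = K by have := ltn_ord c; lia.
by rewrite modnn; lia.
Qed.

Section digit_pair.
Context (R : realType) (m0 : nat) (p q : R).
Hypothesis m0_gt0 : (0 < m0)%N.
Hypothesis p_ge0 : 0 <= p.
Hypothesis p_le_q : p <= q.
Hypothesis q_le1 : q <= 1.
Local Notation pat := (pattern p q).

Definition free_place i : bool := ~~ pat i && ~~ (m0 %| i)%N.

(** The first digit not consumed before place [n]: each place uses one digit for the first sequence,
    and a free place one more for the second. *)
Definition digit_count n := (\sum_(0 <= i < n) (1 + free_place i))%N.

Lemma sqrtn_lt_of_pattern i j M : (i <= j <= i + M)%N -> pat i != pat j ->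
  (sqrtn i < sqrtn (i + M))%N.
Proof.
case/andP=> ij jM pij; apply: (@leq_trans (sqrtn j)); last exact: leq_sqrtn.
rewrite ltn_neqAle leq_sqrtn// andbT; apply: contra pij => /eqP sij.
by rewrite /pattern /= sij.
Qed.

(** The roots of [i] and [i + M] differ only if a square lies in [(i, i + M]]; [sum_sqrtn_add]
    bounds the total of these differences. *)
Lemma sum_bool_le (a b : pred nat) M n :
  (forall i, (a i <= b i + (sqrtn (i + M) - sqrtn i))%N) ->
  (\sum_(0 <= i < n) a i <= \sum_(0 <= i < n) b i + M * sqrtn (n + M))%N.
Proof.
move=> ab; have := sum_sqrtn_add n M => h.
suff : (\sum_(0 <= i < n) a i + \sum_(0 <= i < n) sqrtn i <=
    \sum_(0 <= i < n) b i + \sum_(0 <= i < n) sqrtn (i + M))%N by lia.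
rewrite -!big_split/=; apply: leq_sum => i _.
have : (sqrtn i <= sqrtn (i + M))%N by rewrite leq_sqrtn ?leq_addr.
by have := ab i; lia.
Qed.

Lemma sum_dvdn_le n : (\sum_(0 <= i < n) (m0 %| i) <= n %/ m0 + 1)%N.
Proof.
case: n => [|n]; first by rewrite big_geq.
suff -> : (\sum_(0 <= i < n.+1) (m0 %| i) = n %/ m0 + 1)%N.
  by rewrite leq_add2r leq_div2r.
elim: n => [|n IH]; first by rewrite big_nat1 dvdn0 div0n.
by rewrite big_nat_recr//= IH divnS//; lia.
Qed.

(** A place uses two digits unless it lies in the pattern or is a multiple of [m0], when it uses
    one; these places have upper densities at most [q] and [1 / m0]. *)
Lemma digit_count_ge (s : R) : s < 2 - q - m0%:R^-1 ->
  exists N, forall n, (N <= n)%N -> s * n%:R <= (digit_count n)%:R.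
Proof.
move=> sq; pose e := 2 - q - m0%:R^-1 - s; have e0 : 0 < e by rewrite subr_gt0.
(* The constant 5 absorbs [4 sqrtn n + 1] from [pattern_sum_le] and the 1 from [sum_dvdn_le]. *)
have [N hN] := @sqrtn_little R 5 e (ler0n _ _) e0.
exists N => n Nn; have := hN n Nn.
have h1 : (2 * n <= digit_count n + \sum_(0 <= i < n) pat i + (n %/ m0 + 1))%N.
  apply: (@leq_trans (digit_count n + \sum_(0 <= i < n) pat i +
    \sum_(0 <= i < n) (m0 %| i))%N); last by rewrite leq_add2l sum_dvdn_le.
  rewrite /digit_count -!big_split/= mulnC -[leqLHS](subn0 _).
  have -> : (n * 2 - 0 = \sum_(0 <= i < n) 2)%N by rewrite sum_nat_const_nat; lia.
  apply: leq_sum => i _; rewrite /free_place.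
  by case: (pat i); case: (m0 %| i)%N.
have h2 : (2%:R * n%:R : R) <= (digit_count n)%:R + (\sum_(0 <= i < n) pat i)%:R +
    ((n %/ m0)%:R + 1%:R) by rewrite -natrM -!natrD ler_nat.
have h3 : (n %/ m0)%:R <= m0%:R^-1 * n%:R :> R.
  by rewrite mulrC ler_pdivlMr ?ltr0n// -natrM ler_nat leq_divM.
have := @target_sum_le R p q p_le_q n => h4.
have := @pattern_sum_le R p q p_ge0 p_le_q q_le1 n.
rewrite -natr_sum ler_norml => /andP[_]; rewrite [(4 * _ + 1)%:R]natrD [(4 * _)%:R]natrM.
rewrite [(sqrtn n + 1)%:R]natrD => h5 h6.
have {h6} : 5 * ((sqrtn n)%:R + 1%:R) <= 2 * n%:R - q * n%:R - m0%:R^-1 * n%:R - s * n%:R.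
  by rewrite -!mulrBl.
have s0 : 0 <= (sqrtn n)%:R :> R by [].
lra.
Qed.

Context (K : nat).
Hypothesis K_gt1 : (1 < K)%N.
Local Notation KR := (K%:R : R).

(* Outside the pattern the two sequences are forced to differ at the multiples
   of [m0]; at the remaining places their letters are independent digits. *)
Definition digit_pair (dig : nat -> 'I_K) : fullshift R K * fullshift R K :=
  let x i := dig (digit_count i) in
  (x, fun i => if pat i then x i else
               if (m0 %| i)%N then ordS (x i) else dig (digit_count i).+1).

Lemma digit_pair_agree dig i : pat i -> (digit_pair dig).1 i = (digit_pair dig).2 i.
Proof. by rewrite /digit_pair/= => ->. Qed.

Lemma digit_pair_disagree dig i : ~~ pat i -> (m0 %| i)%N ->
  (digit_pair dig).1 i != (digit_pair dig).2 i.
Proof. by rewrite /digit_pair/= => /negbTE -> ->; rewrite eq_sym ordS_neq. Qed.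

(** Closeness at [i] and membership of [i] in the pattern differ only if the pattern changes within
    [M] places: agreement from a close place reaches a multiple of [m0], which must lie in the
    pattern, and a run of [m] pattern places makes its start close. *)
Lemma close_freq_digit_pair dig e : 0 < e -> e <= KR ^- m0 ->
  exists2 c : R, 0 <= c & forall n,
  `|#|[pred i : 'I_n | mdist (iter i (@fs_shift R K) (digit_pair dig).1)
                            (iter i (@fs_shift R K) (digit_pair dig).2) < e]|%:R
    - target_sum p q n| <= c * (sqrtn n + 1)%:R.
Proof.
move=> e0 em0; have [m me] := Kinv_lt K_gt1 e0.
set z := digit_pair dig.
pose C i := mdist (iter i (@fs_shift R K) z.1) (iter i (@fs_shift R K) z.2) < e.
pose M := maxn m m0.
have sqrt_step i j : (i <= j <= i + M)%N -> pat i != pat j ->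
    (0 < sqrtn (i + M) - sqrtn i)%N.
  by move=> ij pij; rewrite subn_gt0; exact: sqrtn_lt_of_pattern pij.
have C_le i : (C i <= pat i + (sqrtn (i + M) - sqrtn i))%N.
  have [Ci|//] := boolP (C i); have [_|Npi] := boolP (pat i).
    by rewrite leq_addr.
  rewrite add0n.
  (* The least multiple of [m0] from [i] on. *)
  pose j := ((i + m0.-1) %/ m0 * m0)%N.
  have ij : (i <= j <= i + m0)%N.
    have := divn_eq (i + m0.-1) m0; have := ltn_pmod (i + m0.-1) m0_gt0.
    by rewrite /j; lia.
  have zj : z.1 j = z.2 j.
    have := @mdist_fs_lt R K K_gt1 _ _ m0 (j - i) (lt_le_trans Ci em0).
    by rewrite !iter_fs_shift subnKC; [apply; lia|lia].
  apply: (@sqrt_step i j); first by rewrite /M; lia.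
  rewrite (negbTE Npi) eq_sym eqbF_neg negbK; apply: contraT => Npj.
  have := digit_pair_disagree dig Npj (dvdn_mull _ (dvdnn m0)).
  by rewrite -/z -/j zj eqxx.
have C_ge i : (pat i <= C i + (sqrtn (i + M) - sqrtn i))%N.
  have [_|NCi] := boolP (C i); first by rewrite (leq_trans (leq_b1 _))// leq_addr.
  have [pi|//] := boolP (pat i).
  have [j jm Npj] : exists2 j, (j < m)%N & ~~ pat (i + j).
    apply: contrapT => noj; move/negP: NCi; apply.
    apply: le_lt_trans me; apply: mdist_fs_le => // j jm.
    rewrite !iter_fs_shift; apply: digit_pair_agree.
    by apply/negPn/negP => Npj; apply: noj; exists j.
  apply: (@sqrt_step i (i + j)%N); first by rewrite /M; lia.
  by rewrite pi (negbTE Npj).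
(* By [sqrtn (n + M) <= sqrtn n + M], the total error is at most [(4 + M) sqrtn n + M ^ 2 + 1]. *)
exists (4 + M + M ^ 2)%:R => // n; rewrite (card_ord_pred C).
have h1 := sum_bool_le n C_le; have h2 := sum_bool_le n C_ge.
have h3 := @pattern_sum_le R p q p_ge0 p_le_q q_le1 n; rewrite -natr_sum in h3.
have -> : (\sum_(0 <= i < n) C i)%:R - target_sum p q n =
    ((\sum_(0 <= i < n) C i)%:R - (\sum_(0 <= i < n) pat i)%:R) +
    ((\sum_(0 <= i < n) pat i)%:R - target_sum p q n) :> R by ring.
apply: (le_trans (ler_normD _ _)); apply: (@le_trans _ _
  ((M * sqrtn (n + M))%:R + (4 * sqrtn n + 1)%:R)).
  apply: lerD => //; move: h1 h2; rewrite -!(ler_nat R) !natrD ler_norml; lra.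
have := sqrtn_add_leq n M; rewrite -natrD -natrM ler_nat.
move: (sqrtn n) (sqrtn _) => s t; rewrite -mulnn; nia.
Qed.

Lemma digit_pair_distr_eq_set dig : distr_eq_set (@fs_shift R K) p q (digit_pair dig).
Proof.
exists (KR ^- m0); split; first by rewrite invr_gt0 exprn_gt0// ltr0n ltnW.
move=> e /andP[e0 em0]; have [c c0 hc] := close_freq_digit_pair dig e0 em0.
exact: (limits_pattern_like p_ge0 p_le_q q_le1 c0 (close_freq_unit _ _ _ e) hc).
Qed.

End digit_pair.

(** * Base [K] digits of a real number *)

Section digits.
Context (R : realType) (K : nat).
Hypothesis K_gt0 : (0 < K)%N.
Local Notation KR := (K%:R : R).
Implicit Types t : R.

Definition digit t i : 'I_K := Ordinal (ltn_pmod (Num.truncn (t * KR ^+ i.+1)) K_gt0).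

Lemma truncn_mul_natr t : 0 <= t -> (Num.truncn (t * KR) %/ K = Num.truncn t)%N.
Proof.
move=> t0; have K0 : 0 < KR by rewrite ltr0n.
have /andP[h1 h2] := truncn_itv t0.
have /andP[h3 h4] := truncn_itv (mulr_ge0 t0 (ltW K0)).
apply/eqP; rewrite eqn_leq -ltnS ltn_divLR// leq_divRL//; apply/andP; split.
  by rewrite -(ltr_nat R) (le_lt_trans h3)// natrM ltr_pM2r.
by rewrite -ltnS -(ltr_nat R) (le_lt_trans _ h4)// natrM ler_pM2r.
Qed.

(** The first [g] digits determine the integer part of [t K ^ g], so the two scaled numbers lie in
    the same unit interval. *)
Lemma dist_le_of_digits t u g : 0 <= t < 1 -> 0 <= u < 1 ->
  (forall i, (i < g)%N -> digit t i = digit u i) -> `|t - u| <= KR ^- g.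
Proof.
move=> /andP[t0 t1] /andP[u0 u1] tu; have K0 : 0 < KR by rewrite ltr0n.
have Kg0 n : 0 < KR ^+ n by rewrite exprn_gt0.
have tuE : Num.truncn (t * KR ^+ g) = Num.truncn (u * KR ^+ g).
  elim: g tu => [_|g IH tu].
    by rewrite !expr0 !mulr1 !(@truncn_def _ _ 0)// ?t0 ?u0.
  have h x : 0 <= x -> Num.truncn (x * KR ^+ g.+1) =
      (Num.truncn (x * KR ^+ g) * K + digit x g)%N.
    move=> x0; rewrite {1}(divn_eq (Num.truncn _) K); congr (_ * _ + _)%N.
    by rewrite exprSr mulrA truncn_mul_natr// mulr_ge0// ltW.
  by rewrite !h// tu// IH// => i ig; apply: tu; exact: ltnW.
have /andP[h1 h2] := truncn_itv (mulr_ge0 t0 (ltW (Kg0 g))).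
have /andP[h3 h4] := truncn_itv (mulr_ge0 u0 (ltW (Kg0 g))).
rewrite -(ler_pM2r (Kg0 g)) mulVf ?gt_eqF// -[X in _ * X <= _](gtr0_norm (Kg0 g)).
rewrite -normrM mulrBl ler_norml; rewrite -tuE in h3 h4; move: h2 h4; rewrite -natr1.
lra.
Qed.

End digits.

(** Place [n] reveals digit [digit_count n] through the first sequence and, when free, the next
    digit through the second. *)
Lemma digits_of_digit_pair (R : realType) (K m0 : nat) (p q : R)
    (dig dig' : nat -> 'I_K) n :
  (forall i, (i < n)%N ->
     (digit_pair m0 p q dig).1 i = (digit_pair m0 p q dig').1 i /\
     (digit_pair m0 p q dig).2 i = (digit_pair m0 p q dig').2 i) ->
  forall i, (i < digit_count m0 p q n)%N -> dig i = dig' i.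
Proof.
elim: n => [|n IH] eq_pt i; first by rewrite /digit_count big_geq.
rewrite /digit_count big_nat_recr//= -/(digit_count m0 p q n) => ilt.
have [{}ilt|] := ltnP i (digit_count m0 p q n).
  by apply: IH => // j jn; apply: eq_pt; exact: ltnW.
rewrite leq_eqVlt => /predU1P[<-|lti]; first by have [] := eq_pt n (ltnSn n).
have [fr|nfr] := boolP (free_place m0 p q n); last first.
  by move: ilt; rewrite (negbTE nfr); lia.
have -> : i = (digit_count m0 p q n).+1 by move: ilt; rewrite fr; lia.
have [_] := eq_pt n (ltnSn n); move: fr; rewrite /free_place /digit_pair/=.
by case/andP=> /negbTE -> /negbTE ->.
Qed.

(** * Lower bound: pulling covers back to the unit interval *)

Section lower_bound.
Context (R : realType) (K : nat) (p q : R).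
Hypothesis K_gt1 : (1 < K)%N.
Hypothesis p_ge0 : 0 <= p.
Hypothesis p_le_q : p <= q.
Hypothesis q_le1 : q <= 1.
Local Notation KR := (K%:R : R).
Local Notation S := (fullshift R K).
Local Notation D := (distr_eq_set (@fs_shift R K) p q).

Let K_gt0 : (0 < K)%N. Proof. exact: ltnW. Qed.
Let KR_gt0 : 0 < KR. Proof. by rewrite ltr0n. Qed.
Let KR_gt1 : 1 < KR. Proof. by rewrite ltr1n. Qed.

Section cover.
Context (m0 : nat) (s : R) (N : nat).
Hypothesis s_ge0 : 0 <= s.
Hypothesis count_ge : forall n, (N <= n)%N -> s * n%:R <= (digit_count m0 p q n)%:R.

Definition coded (t : R) : S * S := digit_pair m0 p q (digit K_gt0 t).

(** Let [n] be the first place where two members of [U] differ. Then [diam U >= K ^ - n], while all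
    parameters coded in [U] share [digit_count n >= s n] digits, hence lie within [(K ^ - n) ^ s] of
    each other. The bound on [diam U] gives [n >= N], where [count_ge] applies. *)
Lemma coded_preimage_sub_itv (U : set (S * S)) :
  (diam U <= (KR ^- N)%:E)%E ->
  exists c r : R, 0 <= r /\ (r%:E <= diam_pow s U)%E /\
    forall t, 0 <= t < 1 -> U (coded t) -> c - r <= t <= c + r.
Proof.
move=> dU.
(* With at most one parameter coded in [U], radius 0 suffices. *)
have [[t [t01 Ut]]|noU] := pselect (exists t, 0 <= t < 1 /\ U (coded t)); last first.
  exists 0, 0; split => //; split; first exact: diam_pow_ge0.
  by move=> t t01 Ut; case: noU; exists t.
have [[u [u01 Uu ut]]|single] :=
    pselect (exists u, [/\ 0 <= u < 1, U (coded u) & u <> t]); last first.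
  exists t, 0; split => //; split; first exact: diam_pow_ge0.
  move=> u u01 Uu; suff -> : u = t by rewrite subr0 addr0 lexx.
  by apply: contrapT => ut; apply: single; exists u.
pose differ n := exists a b, [/\ U a, U b & a.1 n != b.1 n \/ a.2 n != b.2 n].
(* Otherwise [t] and [u] would share all their digits, since [digit_count m >= m], and be equal. *)
have differ_ex : exists n, `[< differ n >].
  apply: contrapT => nodiff; apply: ut; apply/eqP; rewrite -subr_eq0 -normr_eq0.
  rewrite eq_le normr_ge0 andbT; apply/ler_addgt0Pr => e e0; rewrite add0r.
  have [m me] := Kinv_lt K_gt1 e0; apply: le_trans (ltW me).
  apply: (dist_le_of_digits u01 t01) => i im.
  apply: (@digits_of_digit_pair R K m0 p q _ _ m); last first.
    apply: (leq_trans im); rewrite /digit_count.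
    apply: (@leq_trans (\sum_(0 <= i < m) 1)%N); first by rewrite sum_nat_const_nat subn0 muln1.
    by apply: leq_sum => j _; rewrite leq_addr.
  move=> j _; split; apply/eqP/negPn/negP => h; apply: nodiff; exists j.
    by apply/asboolP; exists (coded u), (coded t); split => //; left.
  by apply/asboolP; exists (coded u), (coded t); split => //; right.
case: (ex_minnP differ_ex) => n /asboolP[a [b [Ua Ub ab]]] nmin.
have KnU : ((KR ^- n)%:E <= diam U)%E.
  apply: le_trans (diam_ge Ua Ub); rewrite lee_fin.
  rewrite [mdist a b]/(prod_dist a b) /prod_dist le_max.
  by case: ab => /(mdist_fs_ge K_gt1) ->; rewrite ?orbT.
have Nn : (N <= n)%N.
  have := le_trans KnU dU; rewrite lee_fin lef_pV2 ?posrE ?exprn_gt0//.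
  by rewrite ler_eXn2l.
exists t, ((KR ^- n) `^ s); split; first exact: powR_ge0.
split.
  rewrite /diam_pow ifF; last by apply/negbTE/set0P; exists a.
  rewrite -poweR_EFin; apply: gt0_ler_poweR => //.
    by rewrite in_itv/= lee_fin leey invr_ge0 exprn_ge0// ltW.
  by rewrite in_itv/= diam_ge0 leey.
move=> v v01 Uv; rewrite -ler_distlC distrC.
apply: (@le_trans _ _ (KR ^- digit_count m0 p q n)).
  apply: (dist_le_of_digits v01 t01).
  apply: digits_of_digit_pair => i im.
  split; apply/eqP/negPn/negP => h; move: im; apply/negP; rewrite -leqNgt;
    apply: nmin; apply/asboolP; exists (coded v), (coded t); split => //.
    by left.
  by right.
rewrite -!powR_invn ?(ltW KR_gt0)// -powRrM; apply: ler_powR; first exact: ltW.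
by rewrite mulNr lerN2 mulrC count_ge.
Qed.

(** The intervals obtained from a cover of [D] cover [[0, 1)] and have total length at most twice
    the sum of the radii, whence the constant one half. *)
Lemma hausdorff_premeasure_distr_eq_set_ge : (0 < m0)%N ->
  ((2^-1)%:E <= hausdorff_premeasure s (KR ^- N) D)%E.
Proof.
move=> m00; apply: le_ereal_inf_tmp => _ [U [DU dU] <-].
have /choice[c /choice[r cr]] := fun i => coded_preimage_sub_itv (dU i).
have r0 i : 0 <= r i by have [] := cr i.
have rU i : ((r i)%:E <= diam_pow s (U i))%E by have [_ []] := cr i.
pose J i : set R := `[c i - r i, c i + r i]%classic.
have JE i : (lebesgue_measure (J i) <= 2%:E * (r i)%:E)%E.
  rewrite lebesgue_measure_itv/=; case: ifPn => _.
    by rewrite -EFinB -EFinM lee_fin; lra.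
  by rewrite mule_ge0// lee_fin.
have cov : `[0, 1[%classic `<=` \bigcup_i J i.
  move=> t; rewrite /= in_itv/= => t01.
  have Dt := digit_pair_distr_eq_set m00 p_ge0 p_le_q q_le1 K_gt1 (digit K_gt0 t).
  have [i _ Ui] := DU _ Dt.
  by exists i => //; rewrite /J /= in_itv/=; have [_ [_]] := cr i; apply.
have : (1 <= \sum_(0 <= i <oo) lebesgue_measure (J i))%E.
  have -> : 1%E = lebesgue_measure (`[0, 1[%classic : set R).
    by rewrite lebesgue_measure_itv/= lte_fin ltr01 oppr0 adde0.
  by apply: measure_sigma_subadditive => // i; exact: measurable_itv.
move=> le1.
rewrite -(@lee_pmul2l _ 2%:E)// -EFinM mulfV//.
apply: (le_trans le1); rewrite -nneseriesZl//; last by move=> *; exact: diam_pow_ge0.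
apply: lee_nneseries => i _ => [_|]; first exact: measure_ge0.
by apply: (le_trans (JE i)); rewrite lee_pmul2l.
Qed.

End cover.

Lemma hausdorff_dim_distr_eq_set_ge : ((2 - q)%:E <= hausdorff_dim D)%E.
Proof.
apply: le_ereal_inf_tmp => _ [s [s0 Hs] <-]; rewrite lee_fin leNgt.
apply/negP => sq; have d0 : 0 < 2 - q - s by lra.
(* The density [1 / m0] of multiples of [m0] has to be smaller than the gap [2 - q - s]. *)
pose m0 := (Num.truncn (2 - q - s)^-1).+1.
have m0_lt : (2 - q - s)^-1 < m0%:R by exact: truncnS_gt.
have sm : s < 2 - q - m0%:R^-1.
  have : m0%:R^-1 < 2 - q - s.
    by rewrite -[ltRHS]invrK ltf_pV2 ?posrE ?invr_gt0// ltr0n.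
  lra.
have [N hN] := digit_count_ge (isT : (0 < m0)%N) p_ge0 p_le_q q_le1 sm.
have h := hausdorff_premeasure_distr_eq_set_ge s0 hN isT.
have : ((2^-1)%:E <= hausdorff_measure s D)%E.
  apply: (le_trans h); apply: ereal_sup_ubound; exists (KR ^- N) => //=.
  by rewrite invr_gt0 exprn_gt0.
by rewrite Hs lee_fin leNgt invr_gt0 ltr0n.
Qed.

End lower_bound.

(** * Inclusion of the two sets and equality of their dimensions *)

Lemma distr_eq_set_sub (R : realType) (X : metricType R) (f : X -> X) (p q : R) :
  distr_eq_set f p q `<=` distr_lim_set f p q.
Proof.
move=> z [e0 [e0_gt0 ze]]; split; apply: cvg_near_cst; near=> e.
- have [|-> _ //] := ze e; apply/andP; split; near: e.
    exact: nbhs_right_gt.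
  exact: nbhs_right_le.
- have [|_ -> //] := ze e; apply/andP; split; near: e.
    exact: nbhs_right_gt.
  exact: nbhs_right_le.
Unshelve. all: by end_near. Qed.

Theorem corollary6p11 (R : realType) (K : nat) (hK : (2 <= K)%N) (p q : R)
  (hp : (0 <= p)%R) (hpq : (p <= q)%R) (hq : (q <= 1)%R) :
  hausdorff_dim (distr_lim_set (@fs_shift R K) p q) = (2 - q)%R%:E /\
  hausdorff_dim (distr_eq_set (@fs_shift R K) p q) = (2 - q)%R%:E.
Proof.
(* The smaller set carries the lower bound and the larger one the upper bound. *)
have sub := @distr_eq_set_sub R _ (@fs_shift R K) p q.
have lo := hausdorff_dim_distr_eq_set_ge hK hp hpq hq.
have hi := hausdorff_dim_distr_lim_set_le hK p hq.
split; apply/eqP; rewrite eq_le.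
  by rewrite hi (le_trans lo (le_hausdorff_dim sub)).
by rewrite lo (le_trans (le_hausdorff_dim sub) hi).
Qed.
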